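(* Let $\mathbf{c}=(c_1,\dots,c_n)$ be a tuple of positive integers and let $C=\sum_{i=1}^n c_i$. Then the characteristic polynomial of the asymmetric $\mathbf{c}$-Catalan arrangement $\mathcal{A}_{\mathrm{Cat}}^{\mathbf{c}}$ in $\mathbb{R}^n$ is $$\chi(\mathcal{A}_{\mathrm{Cat}}^{\mathbf{c}},q)=q\prod_{i=1}^{n-1}(q-C-i).$$ Moreover, the number of regions of $\mathcal{A}_{\mathrm{Cat}}^{\mathbf{c}}$ is $$r(\mathcal{A}_{\mathrm{Cat}}^{\mathbf{c}})=\frac{n!}{C+1}\binom{C+n}{n}.$$
   Context: Notation: $[n]=\{1,\dots,n\}$; for integers $a\le b$, $[a,b]=\{a,a+1,\dots,b\}$. For each $i\in[n]$ put $m_i=(c_i+1)/2$ if $c_i$ is odd and $m_i=c_i/2$ if $c_i$ is even. Let $I=\{i\in[n] : c_i \text{ is odd}\}$ and let $\mathbf{1}_I$ be its indicator function. Asymmetric $\mathbf{c}$-Catalan arrangement: the finite collection $\mathcal{A}_{\mathrm{Cat}}^{\mathbf{c}}$ of all affine hyperplanes $\{x\in\mathbb{R}^n : x_i-x_j=k\}$ with $i\ne j$ in $[n]$ and $k\in[-m_i-m_j+\mathbf{1}_I(i),\; m_i+m_j-\mathbf{1}_I(j)]$. For a hyperplane arrangement $\mathcal{A}$ in $\mathbb{R}^n$, $L(\mathcal{A})$ is the poset of all nonempty intersections of hyperplanes of $\mathcal{A}$ ordered by reverse inclusion, with minimum $\hat0=\mathbb{R}^n$ (the empty intersection); the characteristic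 polynomial is $\chi(\mathcal{A},q)=\sum_{x\in L(\mathcal{A})}\mu(\hat0,x)q^{\dim x}$, where $\mu$ is the Möbius function of $L(\mathcal{A})$. A region of $\mathcal{A}$ is a connected component of $\mathbb{R}^n\setminus\bigcup_{H\in\mathcal{A}}H$, and $r(\mathcal{A})$ is the number of regions. *)

(* Defs.v *)
From HB Require Import structures.
From mathcomp Require Import all_boot all_order all_algebra finmap.
From mathcomp Require Import all_classical all_reals topology normedtype.
From mathcomp Require Import zify.

Set Implicit Arguments.
Unset Strict Implicit.
Unset Printing Implicit Defensive.

Import Order.TTheory GRing.Theory Num.Theory.
Import numFieldNormedType.Exports.

Local Open Scope classical_set_scope.
Local Open Scope ring_scope.

Section Moebius.
Context {T : choiceType}.
Variables (le : rel T) (P : {fset T}).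

(* The recursion
     mu x x = 1   and   mu x y = - \sum_(x <= z < y) mu x z   for x < y
   on the finite poset (P, le), unfolded at most k times. A chain of P has at
   most #|` P| elements, so k = #|` P| is enough: see moebiusxx, moebius_lt. *)
Fixpoint moebius_rec (k : nat) (x y : T) : int :=
  if k is k'.+1 then
    if x == y then 1
    else if le x y then
      - \sum_(z <- P | [&& le x z, le z y & z != y]) moebius_rec k' x z
    else 0
  else 0.

Definition moebius (x y : T) : int := moebius_rec #|` P| x y.

Lemma moebiusxx (x : T) : x \in P -> moebius x x = 1.
Proof.
move=> xP; rewrite /moebius; case E : #|` P| => [|k] /=; last by rewrite eqxx.
by move/eqP: E xP; rewrite cardfs_eq0 => /eqP ->.
Qed.

Hypotheses (rle : reflexive le) (ale : antisymmetric le) (tle : transitive le).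

Lemma moebius_rec_stable (k l : nat) (x y : T) : y \in P ->
    (#|` [fset z in P | le x z && le z y]%fset| <= k)%N ->
    (#|` [fset z in P | le x z && le z y]%fset| <= l)%N ->
  moebius_rec k x y = moebius_rec l x y.
Proof.
have base m y' : y' \in P ->
    (#|` [fset z in P | le x z && le z y']%fset| <= 0)%N ->
    moebius_rec m x y' = 0.
  move=> yP; rewrite leqn0 cardfs_eq0 => /eqP/fsetP/(_ y').
  rewrite !inE yP rle andbT /= => xy.
  by case: m => //= m; rewrite xy; case: eqP xy => // ->; rewrite rle.
elim: k l y => [|k IH] [|l] y yP lek lel //; rewrite ?(base _ _ yP lek) //.
  by rewrite (base _ _ yP lel).
rewrite /=; case: eqP => // xy; case: ifP => // lexy; congr (- _).
rewrite big_seq_cond [RHS]big_seq_cond; apply: eq_bigr => z.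
move=> /andP[zP /and3P[xz zy nzy]].
have lt : (#|` [fset t in P | le x t && le t z]%fset| <
           #|` [fset t in P | le x t && le t y]%fset|)%N.
  apply: fproper_ltn_card; rewrite fproperEneq; apply/andP; split.
    apply/eqP => /fsetP/(_ y); rewrite !inE yP lexy rle /= => yz.
    by move: nzy; rewrite (ale (x := z) (y := y)) ?eqxx // zy yz.
  apply/fsubsetP => t; rewrite !inE => /and3P[-> -> tz] /=; exact: tle tz zy.
by apply: IH => //; rewrite -ltnS; apply: leq_trans lt _.
Qed.

Lemma moebius_lt (x y : T) : y \in P -> le x y -> x != y ->
  moebius x y = - \sum_(z <- P | [&& le x z, le z y & z != y]) moebius x z.
Proof.
move=> yP lexy nxy; rewrite /moebius.
have sub z : (#|` [fset t in P | le x t && le t z]%fset| <= #|` P|)%N.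
  by apply: fsubset_leq_card; apply/fsubsetP => t; rewrite !inE => /andP[].
move: #|` P| sub => N sub.
have -> : moebius_rec N x y = moebius_rec N.+1 x y.
  by apply: moebius_rec_stable => //; apply: leqW.
by rewrite [LHS]/= (negbTE nxy) lexy.
Qed.

End Moebius.

Section AffineDimension.
Context {K : fieldType} {n : nat}.
Implicit Types (F : set 'rV[K]_n) (V : {vspace 'rV[K]_n}).

(* The dimension of an affine subspace F = x + V is \dim V; junk value 0 when F
   is not an affine subspace. *)
Definition affdim F : nat :=
  xget 0%N [set d | exists (x : 'rV[K]_n) V,
    F = [set x + v | v in [set` V]] /\ d = \dim V].

Lemma affdimE (x : 'rV[K]_n) V : affdim [set x + v | v in [set` V]] = \dim V.
Proof.
have sub (a b : 'rV[K]_n) (U W : {vspace 'rV[K]_n}) :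
    [set a + v | v in [set` U]] `<=` [set b + v | v in [set` W]] ->
    (U <= W)%VS.
  move=> UW; apply/subvP => u uU.
  have [|w wW bw] := UW a; first by exists 0; rewrite ?addr0 //=; exact: mem0v.
  have [|w' wW' bw'] := UW (a + u); first by exists u.
  have -> : u = w' - w.
    by apply: (addrI a); rewrite -bw' -bw addrCA addrK addrC.
  exact: memvB.
apply: xget_unique; first by exists x, V.
move=> _ [y [W [E ->]]]; congr (\dim _); apply: subv_anti.
by apply/andP; split; [apply: (sub y x)|apply: (sub x y)]; rewrite E.
Qed.

End AffineDimension.

Section Arrangement.
Context {R : realType} {n : nat}.
Implicit Type A : set (set 'rV[R]_n).

(* The empty subfamily B contributes the whole space. *)
Definition flats A : set (set 'rV[R]_n) :=
  [set F | F !=set0 /\ exists2 B, B `<=` A & F = \bigcap_(H in B) H].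

Lemma finite_flats A : finite_set A -> finite_set (flats A).
Proof.
move=> /finite_fsetP[X ->].
pose inter (Y : {fset set 'rV[R]_n}) := \bigcap_(H in [set` Y]) H.
apply: (@sub_finite_set _ _ (inter @` [set` fpowerset X])).
  move=> F [_ [B BX ->]]; exists [fset H in X | H \in B]%fset.
    by rewrite /= fpowersetE; apply/fsubsetP => H; rewrite !inE => /andP[].
  congr bigcap; apply/seteqP; split => H /=; rewrite !inE.
    by case/andP => _ /set_mem.
  by move=> BH; rewrite mem_set // andbT; exact: BX.
by apply: finite_image; exact: finite_fset.
Qed.

(* Flats are ordered by reverse inclusion: >=%O on sets is superset. fset_set
   is meaningful only for finite sets: see finite_flats. *)
Definition charpoly A : {poly int} :=
  \sum_(F <- fset_set (flats A))
    moebius >=%O (fset_set (flats A)) setT F *: 'X^(affdim F).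

Definition arr_compl A : set 'rV[R]_n := ~` \bigcup_(H in A) H.

Definition regions A : set (set 'rV[R]_n) :=
  [set connected_component (arr_compl A) x | x in arr_compl A].

(* Equal to 0 if there are infinitely many regions. *)
Definition nregions A : nat := #|` fset_set (regions A)|.

End Arrangement.

Section AsymmetricCatalan.
Context {n : nat}.
Variable c : 'I_n -> nat.

Definition cat_half (i : 'I_n) : nat :=
  if odd (c i) then (c i).+1./2 else (c i)./2.

(* The boolean odd (c i), coerced to nat, is the indicator of the set of indices
   whose entry is odd. *)
Definition catalan_lower (i j : 'I_n) : int :=
  - (cat_half i)%:Z - (cat_half j)%:Z + (odd (c i) : nat)%:Z.

Definition catalan_upper (i j : 'I_n) : int :=
  (cat_half i)%:Z + (cat_half j)%:Z - (odd (c j) : nat)%:Z.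

Definition asym_catalan (R : realType) : set (set 'rV[R]_n) :=
  [set H | exists i j : 'I_n, exists k : int,
    [/\ i != j, catalan_lower i j <= k <= catalan_upper i j
      & H = [set x : 'rV[R]_n | x ord0 i - x ord0 j = k%:~R]]].

Arguments asym_catalan : clear implicits.

Lemma finite_asym_catalan (R : realType) : finite_set (asym_catalan R).
Proof.
pose H (ij : 'I_n * 'I_n) (k : int) : set 'rV[R]_n :=
  [set x : 'rV[R]_n | x ord0 ij.1 - x ord0 ij.2 = k%:~R].
pose lo ij := catalan_lower ij.1 ij.2; pose up ij := catalan_upper ij.1 ij.2.
apply: (@sub_finite_set _ _ (\bigcup_(ij in [set: 'I_n * 'I_n])
    ((fun m : nat => H ij (lo ij + m%:Z)) @` `I_(absz (up ij - lo ij)).+1))).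
  move=> _ [i [j [k [_ /andP[lk ku] ->]]]]; exists (i, j) => //=.
  exists (absz (k - catalan_lower i j)).
    by rewrite /= /lo /up /=; lia.
  have -> : lo (i, j) + (absz (k - catalan_lower i j))%:Z = k.
    by rewrite /lo /=; lia.
  by [].
by apply: bigcup_finite => // ij _; apply: finite_image.
Qed.

End AsymmetricCatalan.

Arguments asym_catalan {n} c R.

(* Main.v *)
Require Import Defs.
From mathcomp Require Import all_boot all_order all_algebra finmap.
From mathcomp Require Import all_classical all_reals topology normedtype.
From mathcomp Require Import zify ring lra.

(* Translating coordinate i by cat_half c i turns the hyperplanes into
   y i - y j = k with - c i <= k <= c j.

   Characteristic polynomial (finite field method): for q large, Moebius
   inversion over the flats identifies its value at q with the number of points
   of (Z/q)^n on no hyperplane modulo q, that is, of placements of disjoint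
   arcs [y i, y i + c i] on a circle of q sites. Contracting the arcs one site
   at a time, while keeping one arc fixed, reduces this to counting injections.

   Regions: a region is an interleaving of the n chains of points
   y i, y i + 1, ..., y i + c i. Such an interleaving is determined by the
   positions at which the chains start, all other points being forced to leave a
   queue in first-in-first-out order. A one-line recurrence then gives
   (C + n)! / (C + 1)! interleavings. *)

Set Implicit Arguments.
Unset Strict Implicit.
Unset Printing Implicit Defensive.

Import Order.TTheory GRing.Theory Num.Theory.
Import numFieldNormedType.Exports.

Local Open Scope ring_scope.

(** * Disjoint arcs on a discrete circle *)

Lemma val_subZp p (x y : 'I_p.+1) :
  (x - y : 'I_p.+1) = (if (y <= x)%N then x - y else p.+1 + x - y)%N :> nat.
Proof.
have xp := ltn_ord x; have yp := ltn_ord y.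
rewrite /= modnDmr; case: leqP => yx.
  have -> : (x + (p.+1 - y) = (x - y) + p.+1)%N by lia.
  by rewrite modnDr modn_small //; lia.
have -> : (x + (p.+1 - y) = p.+1 + x - y)%N by lia.
by rewrite modn_small //; lia.
Qed.

Section CircularArcs.
Context {n : nat}.
Implicit Type c : 'I_n -> nat.

(* In Z/(p+1), the arcs [x i, x i + c i] are pairwise disjoint. *)
Definition sep p c (x : {ffun 'I_n -> 'I_p.+1}) :=
  [forall i, forall j, (i != j) ==> (c j < (x i - x j)%R)%N].

Lemma sepP p c (x : {ffun 'I_n -> 'I_p.+1}) :
  reflect (forall i j, i != j -> (c j < (x i - x j)%R)%N) (sep c x).
Proof.
apply: (iffP forallP) => [h i j ij|h i].
  by have /forallP/(_ j)/implyP := h i; apply.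
by apply/forallP => j; apply/implyP; exact: h.
Qed.

(** Rotations preserve disjointness, so each of the [p.+1] positions of arc [i0] accounts for as
    many placements as position 0. *)
Lemma card_sep_rooted p c (i0 : 'I_n) :
  #|[set x | @sep p c x]| = (p.+1 * #|[set x | @sep p c x & x i0 == 0%R]|)%N.
Proof.
pose tr (a : 'I_p.+1) (x : {ffun 'I_n -> 'I_p.+1}) := [ffun i => x i + a].
have tr_inj a : injective (tr a).
  by move=> x y /ffunP xy; apply/ffunP => i; have := xy i; rewrite !ffunE => /addIr.
have sep_tr a x : sep c (tr a x) = sep c x.
  apply/sepP/sepP => h i j ij; have := h i j ij; rewrite !ffunE.
    by rewrite opprD addrACA subrr addr0.
  by rewrite opprD addrACA subrr addr0.
rewrite -sum1_card (partition_big (fun x : {ffun _} => x i0) predT) //=.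
rewrite -[X in (X * _)%N](card_ord p.+1) -sum_nat_const; apply: eq_bigr => a _.
rewrite sum1_card -[RHS](card_imset _ (tr_inj a)); apply: eq_card => x.
apply/idP/imsetP => [|[y]].
  rewrite unfold_in inE => /andP[sx /eqP xa]; exists (tr (- a) x).
    by rewrite !inE sep_tr sx ffunE xa subrr eqxx.
  by apply/ffunP => i; rewrite !ffunE subrK.
rewrite inE => /andP[sy /eqP y0 ->].
by rewrite unfold_in inE sep_tr sy ffunE y0 add0r eqxx.
Qed.

(** Arc [i0] covers the sites 0, ..., [c i0], so all other starts lie beyond [c i0]. Deleting one of
    its sites moves them back by one ([f]); reinserting it is the inverse ([g]). *)
Lemma card_sep_contract p c (i0 : 'I_n) : (0 < c i0)%N ->
  #|[set x | @sep p.+1 c x & x i0 == 0%R]| =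
  #|[set x | @sep p (fun i => c i - (i == i0))%N x & x i0 == 0%R]|.
Proof.
move=> c0.
pose f (x : {ffun 'I_n -> 'I_p.+2}) : {ffun 'I_n -> 'I_p.+1} :=
  [ffun j => inord (x j).-1].
pose g (y : {ffun 'I_n -> 'I_p.+1}) : {ffun 'I_n -> 'I_p.+2} :=
  [ffun j => inord (if j == i0 then 0 else (y j).+1)].
have fK (x : {ffun 'I_n -> 'I_p.+2}) : sep c x -> x i0 = 0 -> g (f x) = x.
  move=> /sepP sx x0.
  suff key j : g (f x) j = x j :> nat by apply/ffunP => j; exact/ord_inj/key.
  rewrite !ffunE; case: (eqVneq j i0) => [->|ji]; first by rewrite inordK // x0.
  have h : (c i0 < x j)%N by have := sx j i0 ji; rewrite x0 subr0.
  have h' := ltn_ord (x j).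
  have E : (inord (x j).-1 : 'I_p.+1) = (x j).-1 :> nat by rewrite inordK //; lia.
  by rewrite E inordK; lia.
have gK (x : {ffun 'I_n -> 'I_p.+1}) : x i0 = 0 -> f (g x) = x.
  move=> x0.
  suff key j : f (g x) j = x j :> nat by apply/ffunP => j; exact/ord_inj/key.
  rewrite !ffunE; case: (eqVneq j i0) => [->|ji].
    have E : (inord 0 : 'I_p.+2) = 0%N :> nat by rewrite inordK.
    by rewrite E x0 inordK.
  have h := ltn_ord (x j).
  have E : (inord (x j).+1 : 'I_p.+2) = (x j).+1 :> nat by rewrite inordK.
  by rewrite E inordK.
have gf (x : {ffun 'I_n -> 'I_p.+2}) : sep c x -> x i0 = 0 ->
    sep (fun i => c i - (i == i0))%N (f x) && (f x i0 == 0).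
  move=> /sepP sx x0; apply/andP; split; last first.
    by rewrite ffunE x0; apply/eqP/ord_inj; rewrite inordK.
  have pos j : j != i0 -> (c i0 < x j)%N by move/(sx j i0); rewrite x0 subr0.
  have x0' : x i0 = 0%N :> nat by rewrite x0.
  have fE j : f x j = (x j).-1 :> nat.
    by rewrite ffunE inordK //; have := ltn_ord (x j); lia.
  apply/sepP => i j ij; have := sx i j ij; rewrite !val_subZp !fE.
  have xi := ltn_ord (x i); have xj := ltn_ord (x j).
  case: (eqVneq j i0) => [E|ji] /=.
    by rewrite -> E in *; rewrite x0' /=; have := pos _ ij; lia.
  have := pos _ ji.
  case: (eqVneq i i0) => [E|ii].
    by rewrite -> E in *; rewrite x0'; do ?case: ifP => ?; lia.
  (* If [x i < x j], the difference on the circle drops by one; the bound survives because arc [j]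
     ends before site 0 and [x i] is positive. *)
  have := sx i0 j; rewrite eq_sym => /(_ ji); rewrite val_subZp x0'.
  by have := pos _ ii; do ?case: ifP => ?; lia.
have fg (x : {ffun 'I_n -> 'I_p.+1}) :
    sep (fun i => c i - (i == i0))%N x -> x i0 = 0 ->
    sep c (g x) && (g x i0 == 0).
  move=> /sepP sx x0; apply/andP; split; last first.
    by rewrite ffunE eqxx; apply/eqP/ord_inj; rewrite inordK.
  have pos j : j != i0 -> (c i0 <= x j)%N.
    by move/(sx j i0); rewrite x0 subr0 eqxx; lia.
  have x0' : x i0 = 0%N :> nat by rewrite x0.
  have gE j : g x j = (if j == i0 then 0 else (x j).+1)%N :> nat.
    by rewrite ffunE inordK //; have := ltn_ord (x j); case: ifP; lia.
  apply/sepP => i j ij; have := sx i j ij; rewrite !val_subZp !gE.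
  have xi := ltn_ord (x i); have xj := ltn_ord (x j).
  case: (eqVneq j i0) => [E|ji] /=.
    rewrite -> E in *; rewrite (negbTE ij) x0'; have := pos _ ij.
    by do ?case: ifP => ?; lia.
  have := pos _ ji.
  case: (eqVneq i i0) => [E|ii].
    by rewrite -> E in *; rewrite x0' /=; case: ifP => ?; lia.
  have := sx i0 j; rewrite eq_sym => /(_ ji); rewrite val_subZp x0' (negbTE ji).
  by have := pos _ ii; do ?case: ifP => ?; lia.
have f_inj : {in [set x | @sep p.+1 c x & x i0 == 0%R] &, injective f}.
  move=> x y; rewrite !inE => /andP[sx /eqP x0] /andP[sy /eqP y0] fxy.
  by rewrite -(fK x) // -(fK y) // fxy.
rewrite -(card_in_imset f_inj); apply: eq_card => x.
apply/imsetP/idP => [[y + ->]|]; rewrite !inE => /andP[sx /eqP x0]; first exact: gf.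
by exists (g x); [rewrite inE; exact: fg|rewrite gK].
Qed.

(** Induction on the sum of the [c i]: a contraction lowers [p] and the sum together and keeps their
    difference. When all [c i] are 0, disjointness is injectivity, and [p.+1 * p ^_ n.-1] is
    [p.+1 ^_ n]. *)
Lemma card_sep p c (i0 : 'I_n) : (\sum_i c i <= p)%N ->
  #|[set x | @sep p c x]| = (p.+1 * (p - \sum_i c i) ^_ n.-1)%N.
Proof.
move Em : (\sum_i c i)%N => m; elim: m p c Em => [|m IH] p c Em mp.
  have c0 i : c i = 0%N.
    by apply/eqP; rewrite -leqn0 -Em (bigD1 i) //= leq_addr.
  rewrite subn0 -ffactnS prednK ?(leq_trans _ (ltn_ord i0)) //.
  rewrite -[X in (X ^_ _)%N](card_ord p.+1) -[X in (_ ^_ X)%N](card_ord n).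
  have pos (u v : 'I_p.+1) : (0 < (u - v)%R)%N = (u != v).
    by rewrite -(subr_eq0 u v) lt0n.
  rewrite -card_inj_ffuns; apply: eq_card => x; rewrite !inE.
  apply/sepP/injectiveP => [h i j xij|h i j ij].
    by apply: contraPeq xij => /h; rewrite c0 pos => /eqP.
  by rewrite c0 pos; apply: contra ij => /eqP/h ->.
have [i ci] : exists i, (0 < c i)%N.
  apply/existsP; apply: contra_eqT Em; rewrite negb_exists => /forallP h.
  by rewrite big1 // => i _; apply/eqP; rewrite -leqn0 leqNgt.
case: p mp => // p mp; rewrite (card_sep_rooted _ _ i) card_sep_contract //.
have Em' : (\sum_j (c j - (j == i)) = m)%N.
  apply/eq_add_S; rewrite -Em (bigD1 i) //= [in RHS](bigD1 i) //=.
  rewrite eqxx -addSn subn1 prednK //.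
  by congr addn; apply: eq_bigr => j /negbTE ->; rewrite subn0.
have := IH p _ Em' mp; rewrite (card_sep_rooted _ _ i) subSS.
by move/eqP; rewrite eqn_pmul2l // => /eqP ->.
Qed.

End CircularArcs.

(** * Interleavings of chains *)

Section MergedChains.
Context {n : nat}.
Variable c : 'I_n -> nat.

Let point := ('I_n * nat)%type.
Implicit Types (Q : seq point) (S : {set 'I_n}).

Definition succs (p : point) : seq point :=
  if (p.2 < c p.1)%N then [:: (p.1, p.2.+1)] else [::].

(* Possible increasing orders of the remaining N points y i + s, s <= c i. Q is
   the first-in-first-out queue of the least remaining points of the chains
   already entered, and S is the set of the chains not yet entered. *)
Fixpoint merges N Q S : seq (seq point) :=
  if N is N'.+1 then
    (if Q is p :: Q' then [seq p :: L | L <- merges N' (Q' ++ succs p) S]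
     else [::]) ++
    [seq (i, 0%N) :: L | i <- enum S,
                         L <- merges N' (Q ++ succs (i, 0%N)) (S :\ i)]
  else [:: [::]].

(** An entry (i, s) stands for the points s, ..., [c i] of its chain, all still to be listed. *)
Definition queue_size Q := (\sum_(p <- Q) (c p.1 - p.2).+1)%N.
(** The points of the chains not yet entered, except their starts, which [#|S|] counts. *)
Definition chains_size S := (\sum_(i in S) (c i))%N.

Definition remaining Q S := (queue_size Q + chains_size S + #|S|)%N.

Definition valid Q S :=
  all [pred p : point | (p.1 \notin S) && (p.2 <= c p.1)%N] Q.

Lemma queue_size_cons p Q : queue_size (p :: Q) = ((c p.1 - p.2).+1 + queue_size Q)%N.
Proof. by rewrite /queue_size big_cons. Qed.

Lemma queue_size_succs Q p :
  queue_size (Q ++ succs p) = (queue_size Q + (c p.1 - p.2))%N.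
Proof.
rewrite /queue_size big_cat /succs; congr addn.
case: ltnP => h; last by rewrite big_nil; lia.
by rewrite big_seq1 /=; lia.
Qed.

Lemma chains_sizeD1 S i : i \in S -> chains_size S = (c i + chains_size (S :\ i))%N.
Proof. by move=> iS; rewrite /chains_size (big_setD1 i). Qed.

Lemma remaining_enqueue N Q S i : i \in S -> N.+1 = remaining Q S ->
  N = remaining (Q ++ succs (i, 0%N)) (S :\ i).
Proof.
move=> iS; rewrite /remaining queue_size_succs /= subn0 (chains_sizeD1 iS).
by rewrite (cardsD1 i) iS addnA addn1 addSn addnA => -[].
Qed.

Lemma remaining_dequeue N p Q S : N.+1 = remaining (p :: Q) S ->
  N = remaining (Q ++ succs p) S.
Proof. by rewrite /remaining queue_size_succs queue_size_cons; lia. Qed.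

Lemma valid_dequeue p Q S : valid (p :: Q) S ->
  [/\ p.1 \notin S, (p.2 <= c p.1)%N & valid (Q ++ succs p) S].
Proof.
rewrite /valid /= all_cat => /andP[/andP[pS pc] ->]; split=> //=.
by rewrite /succs; case: ltnP => //= h; rewrite pS h.
Qed.

Lemma valid_enqueue i Q S : valid Q S -> valid (Q ++ succs (i, 0%N)) (S :\ i).
Proof.
rewrite /valid all_cat => /allP v; apply/andP; split.
  by apply/allP => p /v /= /andP[pS ->]; rewrite !inE (negbTE pS) andbF.
by rewrite /succs; case: ltnP => //= ->; rewrite !inE eqxx.
Qed.

(** With h = [queue_size Q] and C = [chains_size S], the count is (h + 1) N! / (C + h + 1)!.
    Dequeuing lowers h by one and entering chain i moves [c i] from C to h, so the recurrence
    amounts to (C + h + 1) h + sum over i in S of (h + 1 + c i) = (h + 1) (h + C + #|S|). *)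
Lemma size_merges N Q S : N = remaining Q S ->
  (size (merges N Q S) * (chains_size S + queue_size Q).+1`! =
   (queue_size Q).+1 * N`!)%N.
Proof.
elim: N Q S => [|N IH] Q S E /=; have := E; rewrite /remaining => E'.
  have -> : queue_size Q = 0%N by lia.
  by have -> : chains_size S = 0%N by lia.
set h := queue_size Q; set C := chains_size S.
rewrite size_cat mulnDl size_allpairs_dep sumnE big_map big_enum /= big_distrl /=.
have -> : (size match Q with [::] => [::]
     | p :: Q' => [seq p :: L | L <- merges N (Q' ++ succs p) S] end * (C + h).+1`! =
     (C + h).+1 * h * N`!)%N.
  rewrite /h; case: Q E {E'} @h => [|p Q] E h.
    by rewrite /queue_size big_nil muln0.
  rewrite size_map; have := IH (Q ++ succs p) S (remaining_dequeue E).
  rewrite /h queue_size_succs queue_size_cons factS => IH'.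
  rewrite mulnCA -mulnA; congr (_ * _)%N.
  have -> : (C + ((c p.1 - p.2).+1 + queue_size Q) =
    (C + (queue_size Q + (c p.1 - p.2))).+1)%N by lia.
  by rewrite IH'; congr (_ * _)%N; lia.
have -> : (\sum_(i in S) size (merges N (Q ++ succs (i, 0%N)) (S :\ i)) * (C + h).+1`! =
    \sum_(i in S) (h + c i).+1 * N`!)%N.
  apply: eq_bigr => i iS; have := IH (Q ++ succs (i, 0%N)) (S :\ i).
  rewrite queue_size_succs /= subn0 => /(_ (remaining_enqueue iS E)) <-.
  by rewrite /C (chains_sizeD1 iS) /h; congr (_ * (_.+1)`!)%N; lia.
rewrite -big_distrl -mulnDl factS mulnA; congr (_ * _)%N.
rewrite (eq_bigr (fun i => h.+1 + c i)%N); last by move=> i _; lia.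
rewrite big_split /= sum_nat_const -/(chains_size S) -/C.
by rewrite E' -/h -/C; move: #|_| h C => s h C; nia.
Qed.

(** Validity separates the two branches by their first point: the chain of a dequeued point is
    outside [S], that of an entering point is in [S]. *)
Lemma uniq_merges N Q S : valid Q S -> uniq (merges N Q S).
Proof.
elim: N Q S => [|N IH] Q S v //=.
rewrite cat_uniq; apply/and3P; split.
- case: Q v => // p Q /valid_dequeue[_ _ v'].
  by rewrite map_inj_uniq ?IH // => L L' [].
- apply/hasPn => _ /allpairsPdep[i [L [+ _ ->]]]; rewrite mem_enum => iS.
  case: Q v => // p Q /valid_dequeue[pS _ _].
  by apply/mapP => -[L' _ [E _]]; rewrite -E iS in pS.
- apply: allpairs_uniq_dep => [|i _|]; rewrite ?enum_uniq //.
    exact/IH/valid_enqueue.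
  by move=> [i L] [i' L'] _ _ /= [-> ->].
Qed.

Definition in_chain_of (p q : point) := (p.1 == q.1) && (q.2 <= p.2 <= c p.1)%N.

Lemma has_succs p q : (q.2 <= c q.1)%N ->
  in_chain_of p q = (p == q) || has (in_chain_of p) (succs q).
Proof.
case: p q => [i s] [j t]; rewrite /succs /in_chain_of xpair_eqE /= => tc.
case: (eqVneq i j) => [->|ij] /=; last by case: ltnP; rewrite /= ?(negbTE ij).
by case: ltnP => h; rewrite /= ?eqxx; lia.
Qed.

(** Since the listed points do not depend on the merge [L], sorting them by height will recover [L]
    from any point of its cell. *)
Lemma mem_merges N Q S L p : N = remaining Q S -> valid Q S -> L \in merges N Q S ->
  (p \in L) = has (in_chain_of p) Q || ((p.1 \in S) && (p.2 <= c p.1)%N).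
Proof.
elim: N Q S L => [|N IH] Q S L E v /=.
  move: E; rewrite /remaining inE => E /eqP ->; rewrite in_nil.
  have /eqP : #|S| = 0%N by lia.
  rewrite cards_eq0 => /eqP ->; rewrite inE orbF.
  case: Q E {v} => // q Q; rewrite queue_size_cons; lia.
rewrite mem_cat => /orP[].
  case: Q E v => // q Q E /valid_dequeue[qS qc v'] /mapP[L' L'in ->].
  rewrite inE (IH _ _ _ (remaining_dequeue E) v' L'in).
  by rewrite has_cat /= (has_succs _ qc) -!orbA; congr orb; rewrite orbCA.
move=> /allpairsPdep[i [L' [+ L'in ->]]]; rewrite mem_enum => iS.
rewrite inE (IH _ _ _ (remaining_enqueue iS E) (valid_enqueue i v) L'in).
rewrite has_cat -!orbA orbCA; congr orb.
rewrite orbA -has_succs //= /in_chain_of /= !inE.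
by case: (eqVneq p.1 i) => [->|]; rewrite ?iS /= ?orbF.
Qed.

(** * Heights: every interleaving is realized, and every generic point yields one *)

Section Realization.
Context {R : realFieldType}.
Implicit Type y : 'I_n -> R.

Definition height y (p : point) : R := y p.1 + p.2%:R.

Arguments height : simpl never.

(* When the point of height l has just been listed, the queue is sorted and its
   heights lie in (l, l + 1]. *)
Definition window y (l : R) Q :=
  path <%R l (map (height y) Q) && all (fun p => height y p <= l + 1) Q.

(** The successor of [p] lies exactly one unit above [p], hence above the whole queue, whose heights
    are at most l + 1. This is why first-in-first-out order is the order of heights. *)
Lemma window_step y l p Q : path <%R l (map (height y) (p :: Q)) ->
  all (fun q => height y q <= l + 1) Q ->
  window y (height y p) (Q ++ succs p).
Proof.
move=> /= /andP[lp pQ] /allP Ql; have Qp q : q \in Q -> height y q < height y p + 1.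
  by move=> /Ql qp; apply: le_lt_trans qp _; rewrite ltrD2r.
rewrite /window map_cat cat_path pQ all_cat /=; apply/and3P; split.
- rewrite /succs; case: ltnP => //= _; rewrite andbT.
  have -> : height y (p.1, p.2.+1) = height y p + 1 by rewrite /height /= -natr1 addrA.
  case/lastP: Q {lp pQ Ql} Qp => [|Q q] Qp /=; first by rewrite ltrDl.
  by rewrite map_rcons last_rcons Qp // mem_rcons mem_head.
- by apply/allP => q /Qp /ltW.
- rewrite /succs; case: ltnP => //= _; rewrite andbT /height /= -natr1; lra.
Qed.

(** Each chain is placed at the moment it enters, and the chains already entered never move
    again. *)
Lemma merges_realized N Q S L y l : N = remaining Q S -> valid Q S ->
  L \in merges N Q S -> window y l Q ->
  exists2 y', (forall i, i \notin S -> y' i = y i) & path <%R l (map (height y') L).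
Proof.
elim: N Q S L y l => [|N IH] Q S L y l E v /=.
  by rewrite inE => /eqP -> _; exists y.
rewrite mem_cat => /orP[].
  case: Q E v => // q Q E /valid_dequeue[qS qc v'] /mapP[L' L'in ->].
  move=> /andP[pQ /= /andP[_ aQ]].
  have [|y' y'y pL] := IH _ _ _ _ _ _ v' L'in (window_step pQ aQ).
    exact: remaining_dequeue.
  exists y' => //=; have -> : height y' q = height y q by rewrite /height y'y.
  by rewrite pL andbT; case/andP: pQ.
move=> /allpairsPdep[i [L' [+ L'in ->]]] /andP[pQ aQ]; rewrite mem_enum => iS.
(* The entering start goes strictly between the last listed height and the head of the queue, or
   anywhere above [l] if the queue is empty. *)
pose z : R := if Q is q :: _ then (l + height y q) / 2 else l + 1.
have /andP[lz pz] : path <%R l (z :: map (height y) Q).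
  rewrite /z; case: Q pQ {aQ E v L'in z} => [|q Q] /=; first by rewrite ltrDl ltr01.
  by move=> /andP[lq ->]; rewrite andbT; apply/andP; split; lra.
pose y1 j := if j == i then z else y j.
have zE : height y1 (i, 0%N) = z by rewrite /height /y1 eqxx addr0.
have hQ : {in Q, height y1 =1 height y}.
  move=> q /(allP v) /= /andP[qS _]; rewrite /height /y1; case: eqP => // E1.
  by rewrite E1 iS in qS.
have w1 : window y1 (height y1 (i, 0%N)) (Q ++ succs (i, 0%N)).
  apply: (@window_step _ l).
    have /eq_in_map /= -> := hQ.
    by rewrite /= zE lz.
  by apply/allP => q qQ; rewrite hQ //; exact: (allP aQ).
have [|y' y'y pL] := IH _ _ _ _ _ _ (valid_enqueue i v) L'in w1.
  exact: remaining_enqueue.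
have y'i : height y' (i, 0%N) = z by rewrite -zE /height /= y'y // !inE eqxx.
exists y' => [j jS|].
  rewrite y'y; last by rewrite !inE (negbTE jS) andbF.
  by rewrite /y1; case: eqP => // E1; rewrite E1 iS in jS.
by rewrite /= y'i lz; rewrite zE in pL.
Qed.

Definition generic y := forall i j s t, i != j -> (s <= c i)%N -> (t <= c j)%N ->
  height y (i, s) != height y (j, t).

Lemma generic_merge N Q S y l : N = remaining Q S -> valid Q S -> generic y ->
  window y l Q -> (forall i, i \in S -> l < y i) ->
  exists2 L, L \in merges N Q S & path <%R l (map (height y) L).
Proof.
move=> + + gy; elim: N Q S l => [|N IH] Q S l E v w Sl.
  by exists [::].
have hE i : height y (i, 0%N) = y i by rewrite /height addr0.
have enqueue i : i \in S -> (forall j, j \in S -> y i <= y j) ->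
    path <%R l (map (height y) ((i, 0%N) :: Q)) ->
    exists2 L, L \in merges N.+1 Q S & path <%R l (map (height y) L).
  move=> iS imin pQ; have /andP[_ aQ] := w.
  have [|j|L Lin pL] := IH _ _ _ _ (valid_enqueue i v) (window_step pQ aQ).
  - exact: remaining_enqueue.
  - rewrite !inE => /andP[ji jS]; rewrite hE lt_neqAle imin // andbT.
    by have := gy j i 0%N 0%N ji isT isT; rewrite !hE eq_sym.
  exists ((i, 0%N) :: L); last by rewrite /= pL andbT; case/andP: pQ.
  rewrite /= mem_cat; apply/orP; right; apply/allpairsPdep.
  by exists i, L; rewrite mem_enum.
have dequeue p Q' : Q = p :: Q' -> (forall j, j \in S -> height y p < y j) ->
    exists2 L, L \in merges N.+1 Q S & path <%R l (map (height y) L).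
  move=> EQ pS; rewrite EQ in E v w *; have /andP[pQ /= /andP[_ aQ]] := w.
  have [pnS pc v'] := valid_dequeue v.
  have [||L Lin pL] := IH _ _ _ _ v' (window_step pQ aQ).
  - exact: remaining_dequeue.
  - exact: pS.
  exists (p :: L); last by rewrite /= pL andbT; case/andP: pQ.
  by rewrite /= mem_cat map_f.
have [S0|[i0 i0S]] := set_0Vmem S.
  case: Q E {v w enqueue} dequeue => [|p Q'] E; last by apply=> // j; rewrite S0 inE.
  by move: E; rewrite /remaining S0 /queue_size big_nil /chains_size big_set0 cards0.
have [i iS imin] := arg_minP y i0S.
have /andP[pQ _] := w.
case: Q {E} v w pQ dequeue enqueue => [|p Q'] v w pQ dequeue enqueue.
  by apply: (enqueue i) => //=; rewrite hE Sl.
have := gy i p.1 0%N p.2; have [pS pc _] := valid_dequeue v.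
have ip : i != p.1 by apply: contraNneq pS => <-.
rewrite -surjective_pairing hE => /(_ ip isT pc); rewrite neq_lt => /orP[lt|gt].
  by apply: (enqueue i) => //=; rewrite hE Sl // lt /=; case/andP: pQ.
by apply: (dequeue p Q') => // j jS; apply: lt_le_trans gt (imin _ _).
Qed.

End Realization.
End MergedChains.

Local Open Scope classical_set_scope.

(** * The characteristic polynomial *)

Lemma sum_moebius (T : choiceType) (le : rel T) (P : {fset T}) (x y : T) :
  reflexive le -> antisymmetric le -> transitive le ->
  x \in P -> y \in P -> le x y ->
  \sum_(z <- P | le x z && le z y) moebius le P x z = (x == y)%:R.
Proof.
move=> rle ale tle xP yP xy.
rewrite big_mkcond (bigD1_seq y) ?fset_uniq //= xy rle /= -big_mkcondr /=.
have [<-|nxy] := eqVneq x y.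
  rewrite moebiusxx // big1 ?addr0 // => z /and3P[nzx xz zx].
  by case/eqP: nzx; apply: ale; rewrite zx.
rewrite [X in X + _]moebius_lt //; apply/eqP; rewrite addrC subr_eq0; apply/eqP.
by apply: eq_bigl => z; rewrite andbC -andbA.
Qed.

Section Counting.
Context {R : realType} {n : nat}.
Implicit Types (A : set (set 'rV[R]_n)) (F : set 'rV[R]_n).

Lemma flatsT A : flats A setT.
Proof.
split; first by exists 0.
by exists set0; rewrite ?bigcap_set0 //; exact: sub0set.
Qed.

(* Moebius inversion: Phi x plays the role of the smallest flat through x. *)
Lemma charpoly_card A (X : finType) (Phi : X -> set 'rV[R]_n) (q : nat) :
  finite_set A -> (forall x, flats A (Phi x)) ->
  (forall F, flats A F -> #|[pred x | `[< Phi x `<=` F >]]| = (q ^ affdim F)%N) ->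
  (charpoly A).[q%:R] = #|[pred x | `[< Phi x = setT >]]|%:R.
Proof.
move=> finA flPhi cardF; have finF := finite_flats finA.
have inF F : (F \in fset_set (flats A)) = (F \in flats A) by rewrite in_fset_set.
rewrite /charpoly horner_sum big_seq.
under eq_bigr => F.
  rewrite inF => /set_mem/cardF cF; rewrite hornerZ hornerXn -natrX -cF.
  rewrite -sum1_card natr_sum mulr_sumr.
  under eq_bigr do rewrite mulr1.
  over.
rewrite -big_seq; under eq_bigr do rewrite big_mkcond /=.
(* After the exchange, each [x] contributes the sum of the Moebius values over the flats containing
   [Phi x]. These form the interval from [setT] to [Phi x], so the sum is 1 if [Phi x = setT] and 0
   otherwise. *)
rewrite exchange_big /= -sum1_card natr_sum [RHS]big_mkcond /=.
apply: eq_bigr => x _.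
have := @sum_moebius _ >=%O (fset_set (flats A)) setT (Phi x) ge_refl ge_anti ge_trans.
rewrite !inF => /(_ (mem_set (@flatsT A)) (mem_set (flPhi x))).
rewrite subsetEset => /(_ (subsetT _)) => E.
transitivity ((setT == Phi x)%:R : int); last first.
  by rewrite inE; case: eqP => [<-|ne]; [rewrite asboolT|rewrite asboolF // => /esym].
rewrite -E [RHS]big_mkcond; apply: eq_bigr => F _.
rewrite inE; congr (if _ then _ else _); apply/asboolP/andP; rewrite !subsetEset.
  by move=> sub; split=> //; exact: subsetT.
by case.
Qed.

End Counting.

(** * Functions constant on the classes of an idempotent map *)

Section ClassFunctions.
Context {n : nat} (r : 'I_n -> 'I_n).
Hypothesis rK : idempotent_fun r.

Let D := [pred i | r i == i].

(** The values at the fixed points of [r], which represent the classes, are free and determine all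
    others. *)
Lemma card_class_functions (T : finType) (t0 : T) :
  #|[pred z : {ffun 'I_n -> T} | [forall i, z (r i) == z i]]| = (#|T| ^ #|D|)%N.
Proof.
rewrite -(card_pffun_on t0); symmetry.
pose f (w : {ffun 'I_n -> T}) := [ffun i => w (r i)].
have f_inj : {in pffun_on t0 D T &, injective f}.
  move=> w w' /pffun_onP[/supportP sw _] /pffun_onP[/supportP sw' _] /ffunP E.
  apply/ffunP => i; have [iD|iD] := boolP (i \in D).
    by have := E i; rewrite !ffunE (eqP iD).
  by rewrite sw // sw'.
rewrite -(card_in_imset f_inj); apply: eq_card => z; rewrite inE.
apply/imsetP/forallP => [[w _ ->] i|zr].
  by rewrite !ffunE; have /= -> := rK i.
exists [ffun i => if i \in D then z i else t0].
  apply/pffun_onP; split=> //; apply/supportP => i /negbTE iD.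
  by rewrite ffunE iD.
apply/ffunP => i; rewrite !ffunE inE; have /= -> := rK i.
by rewrite eqxx (eqP (zr i)).
Qed.

Lemma dim_class_functions (K : fieldType) : exists2 V : {vspace 'rV[K]_n},
  \dim V = #|D| & forall v, (v \in V) = [forall i, v ord0 (r i) == v ord0 i].
Proof.
have rD i : r i \in D by rewrite inE; have /= -> := rK i.
(* [M] copies the coordinate of each representative to its whole class; its row space is the space
   sought. *)
pose M : 'M[K]_(#|D|, n) := \matrix_(d, j) (enum_val d == r j)%:R.
have ME w j : (w *m M) ord0 j = w ord0 (enum_rank_in (rD j) (r j)).
  rewrite mxE (bigD1 (enum_rank_in (rD j) (r j))) //= mxE enum_rankK_in // eqxx mulr1.
  rewrite big1 ?addr0 // => d nd; rewrite mxE; case: eqP => [E|]; last by rewrite mulr0.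
  by case/eqP: nd; apply: enum_val_inj; rewrite enum_rankK_in.
have Mdiag (w : 'rV[K]_#|D|) d : (w *m M) ord0 (enum_val d) = w ord0 d.
  have /eqP E : enum_val d \in D := enum_valP d.
  by rewrite ME; congr (w _ _); apply: enum_val_inj; rewrite enum_rankK_in.
exists (limg (linfun (mulmxr M))).
  rewrite limg_dim_eq ?dimvf /dim /= ?mul1n //.
  apply/eqP; rewrite capfv; apply/lker0P => w w'; rewrite !lfunE /= => E.
  by apply/rowP => d; rewrite -!Mdiag E.
move=> v; apply/memv_imgP/forallP => [[w _ ->] i|vr].
  rewrite lfunE /= !ME; apply/eqP; congr (w _ _); apply: enum_val_inj.
  by rewrite !enum_rankK_in //; exact: rK.
exists (\row_d v ord0 (enum_val d)); first exact: memvf.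
by rewrite lfunE; apply/rowP => j; rewrite /= ME mxE enum_rankK_in // (eqP (vr j)).
Qed.

End ClassFunctions.

(** * Residues modulo [p.+1] and their integer lifts *)

Lemma dvdz_opp (d m : int) : (d %| - m)%Z = (d %| m)%Z.
Proof. by rewrite !dvdzE abszN. Qed.

Lemma dvdz_small (q : nat) (m : int) : (q %| m)%Z -> (`|m| < q)%N -> m = 0.
Proof.
move=> qm mq; apply/eqP; rewrite -absz_eq0; apply/negPn; rewrite -lt0n; apply/negP => m0.
by move: qm; rewrite dvdzE /= gtnNdvd.
Qed.

Lemma eq_ordz p (x y : 'I_p.+1) : (x == y) = (p.+1 %| x%:Z - y%:Z)%Z.
Proof.
apply/eqP/idP => [->|/dvdz_small xy]; first by rewrite subrr dvdz0.
have xp := ltn_ord x; have yp := ltn_ord y.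
by apply/ord_inj; lia.
Qed.

Lemma dvdz_subZp p (x y : 'I_p.+1) :
  (p.+1 %| ((x - y)%R : 'I_p.+1)%:Z - (x%:Z - y%:Z))%Z.
Proof.
rewrite val_subZp; case: leqP => yx; first by rewrite -subzn // subrr dvdz0.
have yp := ltn_ord y.
have -> : (p.+1 + x - y)%N%:Z - (x%:Z - y%:Z) = p.+1%:Z by lia.
exact: dvdzz.
Qed.

Definition resz p (m : int) : 'I_p.+1 := inord `|(m %% p.+1%:Z)%Z|%N.

Lemma dvdz_resz p m : (p.+1 %| (resz p m)%:Z - m)%Z.
Proof.
have m0 : (m %% p.+1)%Z >= 0 by apply: modz_ge0.
have mp : (m %% p.+1)%Z < p.+1 by apply: ltz_pmod.
rewrite /resz inordK; last by lia.
rewrite gez0_abs //; apply/dvdzP; exists (- (m %/ p.+1)%Z).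
by rewrite mulNr [X in _ - X](divz_eq m p.+1) opprD addrCA subrr addr0.
Qed.

(* Some block of K consecutive residues avoids all the y i; cutting the circle
   there turns congruences x = k mod q with |k| <= K into equalities. *)
Lemma unwrap_residues n p (y : {ffun 'I_n -> 'I_p.+1}) (K : nat) :
  (n.+1 * K <= p.+1)%N -> exists u : 'I_n -> int,
    (forall i j, (p.+1 %| (u i - u j) - ((y i)%:Z - (y j)%:Z))%Z) /\
    (forall i j (k : int), (`|k| <= K)%N ->
       (p.+1 %| (y i)%:Z - (y j)%:Z - k)%Z -> u i - u j = k).
Proof.
move=> nK.
(* Pigeonhole: there are [n.+1] disjoint blocks and only [n] residues. *)
have [s sfree] : exists s : 'I_n.+1, forall i, ~~ (s * K <= y i < s * K + K)%N.
  apply/not_existsP => h.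
  have {}h (s : 'I_n.+1) : exists i, (s * K <= y i < s * K + K)%N.
    by have /existsNP[i /negP/negPn] := h s; exists i.
  have [f fP] := choice h.
  have f_inj : injective f.
    move=> s t st; have := fP s; have := fP t; rewrite st; move: (y (f t)) => z.
    move=> hs ht; apply: ord_inj; nia.
  by have := leq_card _ f_inj; rewrite !card_ord ltnn.
have sK : (s * K + K <= p.+1)%N.
  by rewrite -mulSnr; apply: leq_trans nK; rewrite leq_mul2r ltn_ord orbT.
(* Residues before the free block move up by one turn. All [u i] then lie in a window of length
   [p.+1 - K], so [u i - u j - k] is less than [p.+1] in absolute value. *)
pose u i : int := if (y i < s * K)%N then (y i)%:Z + p.+1%:Z else (y i)%:Z.
have uE i : exists e : int, u i = (y i)%:Z + e * p.+1%:Z.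
  by rewrite /u; case: ifP => _; [exists 1|exists 0]; lia.
have ub i : (s * K + K)%N%:Z <= u i < (s * K)%N%:Z + p.+1%:Z.
  have := sfree i; have := ltn_ord (y i); rewrite /u.
  by case: ifP; lia.
have uu i j : (p.+1 %| (u i - u j) - ((y i)%:Z - (y j)%:Z))%Z.
  have [e ->] := uE i; have [e' ->] := uE j; apply/dvdzP; exists (e - e').
  by rewrite mulrBl; lia.
exists u; split=> // i j k kK ijk.
have d : (p.+1 %| u i - u j - k)%Z.
  have -> : u i - u j - k =
      (u i - u j - ((y i)%:Z - (y j)%:Z)) + ((y i)%:Z - (y j)%:Z - k) by lia.
  exact: rpredD.
suff /(dvdz_small d) : (absz (u i - u j - k)%R < p.+1)%N by lia.
by have := ub i; have := ub j; lia.
Qed.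

(** * Flats of arrangements of hyperplanes x i - x j = k with k an integer *)

Section AffinographicFlats.
Context {R : realType} {n : nat}.
Implicit Types (F : set 'rV[R]_n) (v : 'rV[R]_n).

Definition hplane (i j : 'I_n) (k : int) : set 'rV[R]_n :=
  [set x | x ord0 i - x ord0 j = k%:~R].

(** An equivalence relation on the indices; its classes are the blocks of the flat [F]. *)
Definition tied F (i j : 'I_n) : bool :=
  `[< exists k : int, F `<=` hplane i j k >].

Variable A : set (set 'rV[R]_n).
Hypothesis hA : forall H, A H -> exists i j k, H = hplane i j k.

(** Taking floors coordinatewise preserves every equation x i - x j = k with k an integer. *)
Lemma flat_int_point F : flats A F -> exists p : 'I_n -> int, F (\row_i (p i)%:~R).
Proof.
move=> [[v Fv] [B BA E]]; exists (fun i => Num.floor (v ord0 i)); rewrite E => H BH.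
have [i [j [k Hk]]] := hA (BA _ BH); rewrite Hk /hplane /= !mxE.
have : hplane i j k v by rewrite -Hk; move: Fv; rewrite E; apply.
rewrite /hplane /= => /eqP; rewrite subr_eq => /eqP ->.
by rewrite floorDzr ?intr_int // intrKfloor intrD addrK.
Qed.

Lemma tiedxx F i : tied F i i.
Proof. by apply/asboolP; exists 0 => v _; rewrite /hplane /= subrr. Qed.

Lemma tied_sym F i j : tied F i j -> tied F j i.
Proof.
move=> /asboolP[k h]; apply/asboolP; exists (- k) => v /h.
by rewrite /hplane /= intrN => <-; rewrite opprB.
Qed.

Lemma tied_trans F j i k : tied F i j -> tied F j k -> tied F i k.
Proof.
move=> /asboolP[a h] /asboolP[b h']; apply/asboolP; exists (a + b) => v Fv.
have := h v Fv; have := h' v Fv; rewrite /hplane /= intrD => <- <-.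
by rewrite addrA subrK.
Qed.

Lemma tiedE F (p : 'I_n -> int) i j v : F (\row_i (p i)%:~R) -> tied F i j -> F v ->
  v ord0 i - v ord0 j = (p i - p j)%:~R.
Proof.
move=> Fp /asboolP[k h] Fv; have := h _ Fv; have := h _ Fp.
by rewrite /hplane /= !mxE intrB => -> ->.
Qed.

(** Every hyperplane defining [F] ties its two indices, so the ties together with one integer point
    cut out [F]. *)
Lemma flat_tied F (p : 'I_n -> int) v : flats A F -> F (\row_i (p i)%:~R) ->
  F v <-> forall i j, tied F i j -> v ord0 i - v ord0 j = (p i - p j)%:~R.
Proof.
move=> [_ [B BA E]] Fp; split=> [Fv i j ij|h]; first exact: tiedE ij Fv.
rewrite E => H BH; have [i [j [k Hk]]] := hA (BA _ BH).
have FH : F `<=` hplane i j k by rewrite -Hk E => x; apply.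
have := FH _ Fp; rewrite Hk /hplane /= !mxE h ?intrB //.
by apply/asboolP; exists k.
Qed.

(** Tied indices have equal predicates, on which [pick] takes the same value: this is a canonical
    representative of the block of [i]. *)
Definition tied_rep F i := odflt i [pick j | tied F i j].

Lemma tied_repP F i : tied F i (tied_rep F i).
Proof. by rewrite /tied_rep; case: pickP => //= _; exact: tiedxx. Qed.

Lemma eq_tied_rep F i j : (tied_rep F i == tied_rep F j) = tied F i j.
Proof.
apply/eqP/idP => [E|ij].
  by apply: tied_trans (tied_repP F i) _; rewrite E; exact/tied_sym/tied_repP.
have ee : tied F i =1 tied F j.
  by move=> k; apply/idP/idP; apply: tied_trans => //; exact: tied_sym.
rewrite /tied_rep (eq_pick ee); case: pickP => //= h.
by have := h j; rewrite tiedxx.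
Qed.

Lemma tied_repK F : idempotent_fun (tied_rep F).
Proof. by move=> i; apply/eqP; rewrite /= eq_tied_rep; exact/tied_sym/tied_repP. Qed.

(** [F] is the translate, by an integer point, of the space of vectors constant on the blocks. *)
Lemma affdim_flat F : flats A F ->
  affdim F = #|[pred i | tied_rep F i == i]|.
Proof.
move=> flF; have [p Fp] := flat_int_point flF.
have [V <- VE] := dim_class_functions (@tied_repK F) R.
suff -> : F = [set \row_i (p i)%:~R + v | v in [set` V]] by rewrite affdimE.
apply/seteqP; split=> [v Fv|_ [v vV <-]].
  exists (v - \row_i (p i)%:~R); last by rewrite addrC subrK.
  rewrite /= VE; apply/forallP => i; rewrite !mxE; apply/eqP.
  have := tiedE Fp (tied_repP F i) Fv; rewrite intrB; lra.
move: vV; rewrite /= VE => /forallP vV; apply/(flat_tied _ flF Fp) => i j ij.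
rewrite !mxE -(eqP (vV i)) -(eqP (vV j)).
have /eqP -> : tied_rep F i == tied_rep F j by rewrite eq_tied_rep.
by rewrite opprD addrACA subrr addr0 intrB.
Qed.

(** Modulo [q.+1] too, the solutions form a translate of the functions constant on the blocks:
    subtracting the residues of [p i - b i] removes the constants. The shift [b] will be
    [cat_half c]. *)
Lemma card_flat_mod F (p b : 'I_n -> int) q : flats A F ->
  #|[pred y : {ffun 'I_n -> 'I_q.+1} | [forall i, forall j, tied F i j ==>
     (q.+1 %| (y i)%:Z - (y j)%:Z + b i - b j - (p i - p j))%Z]]| =
  (q.+1 ^ affdim F)%N.
Proof.
move=> flF; rewrite affdim_flat // -[X in (X ^ _)%N](card_ord q.+1).
rewrite -(card_class_functions (@tied_repK F) ord0).
pose t i := resz q (p i - b i).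
pose tr (y : {ffun 'I_n -> 'I_q.+1}) := [ffun i => y i - t i].
have tr_inj : injective tr.
  by move=> x y /ffunP xy; apply/ffunP => i; have := xy i; rewrite !ffunE => /addIr.
rewrite -(card_imset _ tr_inj).
have key (y : {ffun 'I_n -> 'I_q.+1}) i j : (tr y i == tr y j) =
    (q.+1 %| (y i)%:Z - (y j)%:Z + b i - b j - (p i - p j))%Z.
  rewrite eq_ordz !ffunE.
  have /dvdzP[e1 E1] := dvdz_subZp (y i) (t i).
  have /dvdzP[e2 E2] := dvdz_subZp (y j) (t j).
  have /dvdzP[e3 E3] := dvdz_resz q (p i - b i).
  have /dvdzP[e4 E4] := dvdz_resz q (p j - b j).
  have -> : ((y i - t i)%R : 'I_q.+1)%:Z - ((y j - t j)%R : 'I_q.+1)%:Z =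
     ((y i)%:Z - (y j)%:Z + b i - b j - (p i - p j)) + (e1 - e2 - e3 + e4) * q.+1%:Z.
    rewrite !mulrDl !mulNr -E1 -E2 -E3 -E4 /t; lia.
  by rewrite rpredDr // dvdz_mull.
apply: eq_card => z; rewrite inE; apply/imsetP/forallP => [[y + ->] i|zr].
  rewrite inE => /forallP h; rewrite key.
  have /forallP/(_ i)/implyP := h (tied_rep F i); apply.
  exact/tied_sym/tied_repP.
exists [ffun i => z i + t i]; last by apply/ffunP => i; rewrite !ffunE addrK.
rewrite inE; apply/forallP => i; apply/forallP => j; apply/implyP => ij.
rewrite -key !ffunE !addrK -(eqP (zr i)) -(eqP (zr j)).
by have /eqP -> : tied_rep F i == tied_rep F j by rewrite eq_tied_rep.
Qed.

End AffinographicFlats.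

(** * Finite field method for the asymmetric Catalan arrangement *)

Section CatalanCharpoly.
Context {R : realType} {n : nat}.
Variable c : 'I_n -> nat.

(** Because [c i] is twice [cat_half c i] minus the parity of [c i], the translation absorbs both
    indicator terms. *)
Lemma catalan_rangeE i j (k : int) :
  (catalan_lower c i j <= k <= catalan_upper c i j) =
  (- (c i)%:Z <= k - (cat_half c i)%:Z + (cat_half c j)%:Z <= (c j)%:Z).
Proof.
rewrite /catalan_lower /catalan_upper.
have halfE l : c l = (cat_half c l + cat_half c l - odd (c l))%N /\
    (odd (c l) <= cat_half c l)%N.
  by have := odd_double_half (c l); rewrite /cat_half -addnn; case: ifP => /= o; lia.
have [Ei oi] := halfE i; have [Ej oj] := halfE j.
move: (cat_half c i) (cat_half c j) (odd (c i) : nat) (odd (c j) : nat) Ei Ej oi oj.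
move: (c i) (c j) => ci cj hi hj o1 o2; lia.
Qed.

(** Here [y] is in translated coordinates; the original point is [y i + cat_half c i]. *)
Definition on_hplane p (y : {ffun 'I_n -> 'I_p.+1}) (i j : 'I_n) (k : int) : bool :=
  (p.+1 %| (y i)%:Z - (y j)%:Z + (cat_half c i)%:Z - (cat_half c j)%:Z - k)%Z.

(** The map [Phi] of [charpoly_card]: the real intersection of the hyperplanes that contain [y]
    modulo [p.+1]. *)
Definition mod_flat p (y : {ffun 'I_n -> 'I_p.+1}) : set 'rV[R]_n :=
  \bigcap_(H in [set H | exists i j, exists k : int, [/\ i != j,
    catalan_lower c i j <= k <= catalan_upper c i j, on_hplane y i j k
    & H = hplane i j k]]) H.

Lemma catalan_hplane H : asym_catalan c R H -> exists i j k, H = hplane i j k.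
Proof. by move=> [i [j [k [_ _ ->]]]]; exists i, j, k. Qed.

(** For [p] large, one integer lift of [y] satisfies all its congruences as equalities, so the real
    intersection is nonempty. The sum of the [c i] bounds every translated constant. *)
Lemma mod_flat_lift p (y : {ffun 'I_n -> 'I_p.+1}) : (n.+1 * \sum_i c i <= p.+1)%N ->
  exists w : 'I_n -> int, mod_flat y (\row_i (w i)%:~R) /\
    forall i j, on_hplane y i j (w i - w j).
Proof.
move=> big; have [u [uu uK]] := unwrap_residues y big.
have cC i : (c i <= \sum_i c i)%N by rewrite (bigD1 i) //= leq_addr.
exists (fun i => u i + (cat_half c i)%:Z); split=> [H|i j].
  move=> [i [j [k [ij kr yk ->]]]]; rewrite /hplane /= !mxE -intrB; congr (_ %:~R).
  move: kr; rewrite catalan_rangeE => kr.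
  suff : u i - u j = k - (cat_half c i)%:Z + (cat_half c j)%:Z by lia.
  apply: uK; first by have := cC i; have := cC j; lia.
  by move: yk; rewrite /on_hplane; congr (_ %| _)%Z; lia.
have := uu i j; rewrite -dvdz_opp /on_hplane; congr (_ %| _)%Z; lia.
Qed.

(** If [F] contains [mod_flat y], it contains the lift of [y], whose differences along ties are
    those of [q]. Conversely, each hyperplane defining [F] is then among those intersected in
    [mod_flat y]. *)
Lemma mod_flat_sub p (y : {ffun 'I_n -> 'I_p.+1}) F (q : 'I_n -> int) :
  (n.+1 * \sum_i c i <= p.+1)%N -> flats (asym_catalan c R) F ->
  F (\row_i (q i)%:~R) ->
  mod_flat y `<=` F <-> forall i j, tied F i j -> on_hplane y i j (q i - q j).
Proof.
move=> big flF Fq; split=> [sub i j ij|h v yv].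
  have [w [/sub Fw wy]] := mod_flat_lift y big.
  have := tiedE Fq ij Fw; rewrite !mxE -intrB => /eqP.
  by rewrite eqr_int => /eqP <-; exact: wy.
have [_ [B BA E]] := flF; rewrite E => H BH.
have [i [j [k [ij kr Hk]]]] := BA _ BH.
apply: yv; exists i, j, k; split=> //.
have FH : F `<=` hplane i j k by move=> x; rewrite E => /(_ _ BH); rewrite Hk.
suff <- : q i - q j = k by apply: h; apply/asboolP; exists k.
by have /eqP := FH _ Fq; rewrite !mxE -intrB eqr_int => /eqP.
Qed.

Lemma mod_flatT p (y : {ffun 'I_n -> 'I_p.+1}) : (\sum_i c i <= p)%N ->
  mod_flat y = setT <-> sep c y.
Proof.
move=> big; have cp i : (c i <= p)%N.
  by apply: leq_trans big; rewrite (bigD1 i) //= leq_addr.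
split=> [yT|/sepP sy]; last first.
  apply/seteqP; split=> // v _ H [i [j [k [ij]]]].
  rewrite catalan_rangeE /on_hplane => kr yk _; exfalso.
  set k' := k - _ + _ in kr.
  have yk' : (p.+1 %| (y i)%:Z - (y j)%:Z - k')%Z.
    by move: yk; congr (_ %| _)%Z; rewrite /k'; lia.
  (* If [k'] is nonnegative, the start of arc [i] falls in arc [j]; otherwise the start of arc [j]
     falls in arc [i]. *)
  have [k0|k0] := leP 0 k'.
    have lt := sy i j ij; have := dvdz_subZp (y i) (y j).
    move=> /(rpredD yk'); move: lt; move: ((y i - y j)%R : 'I_p.+1) => z zc.
    move=> d; have := ltn_ord z; have := cp j.
    have /dvdz_small : (p.+1 %| z%:Z - k')%Z by move: d; congr (_ %| _)%Z; lia.
    by lia.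
  have lt := sy j i; rewrite eq_sym in lt; have := dvdz_subZp (y j) (y i).
  move: yk'; rewrite -dvdz_opp => yk' /(rpredD yk').
  move: (lt ij); move: ((y j - y i)%R : 'I_p.+1) => z zc.
  move=> d; have := ltn_ord z; have := cp i.
  have /dvdz_small : (p.+1 %| z%:Z + k')%Z by move: d; congr (_ %| _)%Z; lia.
  by lia.
apply/sepP => i j ij; rewrite ltnNge; apply/negP => yij.
pose k := ((y i - y j)%R : 'I_p.+1)%:Z + (cat_half c i)%:Z - (cat_half c j)%:Z.
(* A point off the hyperplane: its difference of coordinates is k + 1. *)
have /(_ (\row_l (if l == i then k + 1 else 0)%:~R)) : [set: 'rV[R]_n] `<=` hplane i j k.
  rewrite -yT => v; apply; exists i, j, k; split=> //.
    by rewrite catalan_rangeE /k; lia.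
  have := dvdz_subZp (y i) (y j); rewrite -dvdz_opp /on_hplane.
  by congr (_ %| _)%Z; rewrite /k; lia.
move=> /(_ I); rewrite /hplane /= !mxE eqxx eq_sym (negbTE ij) -intrB => /eqP.
by rewrite eqr_int; lia.
Qed.

Lemma flats_mod_flat p (y : {ffun 'I_n -> 'I_p.+1}) :
  (n.+1 * \sum_i c i <= p.+1)%N -> flats (asym_catalan c R) (mod_flat y).
Proof.
move=> big; split.
  by have [w [wF _]] := mod_flat_lift y big; exists (\row_i (w i)%:~R).
eexists; last by []; by move=> H [i [j [k [ij kr _ ->]]]]; exists i, j, k.
Qed.

Lemma charpoly_eval p (i0 : 'I_n) : (n.+1 * \sum_i c i <= p)%N ->
  (charpoly (asym_catalan c R)).[p.+1%:R] =
    (p.+1 * (p - \sum_i c i) ^_ n.-1)%N%:R.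
Proof.
move=> big; have big' := leqW big.
have Cp : (\sum_i c i <= p)%N by apply: leq_trans big; rewrite leq_pmull.
rewrite -(card_sep i0 Cp) (@charpoly_card _ _ _ _ (@mod_flat p)).
- congr (_%:R); apply: eq_card => y; rewrite !inE.
  by apply/asboolP/idP => /mod_flatT; apply.
- exact: finite_asym_catalan.
- by move=> y; exact: flats_mod_flat.
move=> F flF; have [q Fq] := flat_int_point catalan_hplane flF.
rewrite -(card_flat_mod catalan_hplane q (fun i => (cat_half c i)%:Z) p flF).
apply: eq_card => y; rewrite !inE.
apply/asboolP/forallP => [/(mod_flat_sub y big' flF Fq) h i|h].
  by apply/forallP => j; apply/implyP => /h.
apply/(mod_flat_sub y big' flF Fq) => i j ij.
by have /forallP/(_ j)/implyP := h i; apply.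
Qed.

Lemma charpoly_asym_catalan (i0 : 'I_n) :
  charpoly (asym_catalan c R) =
    'X * \prod_(1 <= i < n) ('X - ((\sum_i c i)%N%:R)%:P - (i%:R)%:P).
Proof.
set C := (\sum_i c i)%N; set Q := RHS; set P := LHS.
apply/eqP; rewrite -subr_eq0; apply/negPn/negP => PQ.
(* From [N] on, [charpoly_eval] applies and no subtraction in the falling factorial truncates. This
   gives [size (P - Q)] distinct roots, too many for a nonzero polynomial. *)
pose N := (n.+1 * C + n)%N.
pose rs : seq int := [seq ((N + t).+1)%:R | t <- iota 0 (size (P - Q))].
suff /(max_poly_roots PQ) : all (root (P - Q)) rs.
  rewrite size_map size_iota ltnn => H; suff : false by []; apply: H.
  by rewrite map_inj_uniq ?iota_uniq // => a b /eqP; rewrite eqr_nat => /eqP; lia.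
apply/allP => _ /mapP[t _ ->]; rewrite rootE hornerD hornerN subr_eq0; apply/eqP.
rewrite /P (charpoly_eval i0); last by rewrite /N; lia.
rewrite /Q hornerM hornerX horner_prod natrM; congr (_ * _).
rewrite ffact_prod natr_prod big_add1 big_mkord; apply: eq_bigr => i _.
rewrite !hornerE -/C; have := ltn_ord i; rewrite /N; lia.
Qed.

End CatalanCharpoly.

(** * The regions *)

Section Connected.
Context {R : realType}.

(** Intermediate value theorem: the image of [D] is an interval that misses [b]. *)
Lemma connected_lt (T : topologicalType) (D : set T) (f : T -> R) (b : R) x z :
  connected D -> continuous f -> (forall t, D t -> f t != b) ->
  D x -> D z -> f x < b -> f z < b.
Proof.
move=> cD cf Db Dx Dz fx; rewrite ltNge; apply/negP => bz.
have /connected_intervalP itv : connected (f @` D).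
  by apply: connected_continuous_connected => //; exact: continuous_subspaceT.
have [| | |t Dt ft] := itv (f x) (f z) _ _ b.
- by exists x.
- by exists z.
- by rewrite (ltW fx).
by have := Db _ Dt; rewrite ft eqxx.
Qed.

Lemma connected_component_segment n (D : set 'rV[R]_n) (x z : 'rV[R]_n) :
  (forall t : R, 0 <= t <= 1 -> D (x + t *: (z - x))) ->
  connected_component D x z.
Proof.
move=> seg; pose f (t : R) : 'rV[R]_n := x + t *: (z - x).
exists (f @` `[0, 1]); last first.
  exists 1; first by rewrite /= in_itv /= ler01 lexx.
  by rewrite /f scale1r addrC subrK.
split.
- exists 0; first by rewrite /= in_itv /= ler01 lexx.
  by rewrite /f scale0r addr0.
- by move=> _ [t + <-]; rewrite /= in_itv /= => t01; exact: seg.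
apply: connected_continuous_connected; first exact: segment_connected.
apply: continuous_subspaceT => t.
by apply: cvgD; [exact: cvg_cst|apply: cvgZr_tmp; exact: cvg_id].
Qed.

End Connected.

(** * Regions as cells of interleavings *)

Section Regions.
Context {R : realType} {n : nat}.
Variable c : 'I_n -> nat.
Let point := ('I_n * nat)%type.

Let start (x : 'rV[R]_n) (i : 'I_n) : R := x ord0 i - (cat_half c i)%:R.

(** Equal heights of (i, s) and (j, t) mean a translated difference t - s, which lies between
    [- c i] and [c j]. Conversely, each integer in that range is such a t - s with s or t equal to
    0. *)
Lemma arr_compl_generic x :
  arr_compl (asym_catalan c R) x <-> generic c (start x).
Proof.
split=> [xA i j s t ij si tj|gx [_ [i [j [k [ij + ->]]]]]].
  apply/eqP; rewrite /height /start /= => E; apply: xA.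
  pose k : int := (cat_half c i)%:Z - (cat_half c j)%:Z + t%:Z - s%:Z.
  exists (hplane i j k).
    by exists i, j, k; split=> //; rewrite catalan_rangeE /k; lia.
  by rewrite /hplane /= /k !(intrD, intrB) -!pmulrn; lra.
rewrite catalan_rangeE => kr /= xk.
pose k' := k - (cat_half c i)%:Z + (cat_half c j)%:Z.
pose s := if k' <= 0 then `|k'|%N else 0%N.
pose t := if k' <= 0 then 0%N else `|k'|%N.
have si : (s <= c i)%N by rewrite /s /k'; case: ifP; lia.
have ti : (t <= c j)%N by rewrite /t /k'; case: ifP; lia.
have kst : k' = t%:Z - s%:Z by rewrite /s /t; case: ifP; lia.
have /eqP := gx i j s t ij si ti; apply; rewrite /height /start /=.
have : (k'%:~R : R) = t%:R - s%:R by rewrite kst intrB -!pmulrn.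
by rewrite /k' !(intrD, intrB) -xk -!pmulrn; lra.
Qed.

Definition below (x : 'rV[R]_n) : rel point :=
  fun p q => height (start x) p < height (start x) q.

Definition cell (L : seq point) : set 'rV[R]_n := [set x | sorted (below x) L].

Definition catalan_merges : seq (seq point) :=
  merges c (remaining c [::] [set: 'I_n]%SET) [::] [set: 'I_n]%SET.

Lemma mem_catalan_merges L p : L \in catalan_merges ->
  (p \in L) = (p.2 <= c p.1)%N.
Proof. by move=> Lin; rewrite (mem_merges p _ _ Lin) //= inE. Qed.

Lemma below_trans x : transitive (below x).
Proof. by move=> q p r; exact: lt_trans. Qed.

Lemma below_irr x : irreflexive (below x).
Proof. by move=> p; exact: ltxx. Qed.

Lemma cell_generic L x : L \in catalan_merges -> cell L x -> generic c (start x).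
Proof.
move=> Lin sx i j s t ij si tj; rewrite neq_lt.
have pL : (i, s) \in L by rewrite mem_catalan_merges.
have qL : (j, t) \in L by rewrite mem_catalan_merges.
have := sorted_ltn_index (@below_trans x) sx.
case: (ltngtP (index (i, s) L) (index (j, t) L)) => [lt|gt|E] h.
- by apply/orP; left; exact: h lt.
- by apply/orP; right; exact: h gt.
have := nth_index (i, s) pL; rewrite E nth_index // => -[ji _].
by rewrite ji eqxx in ij.
Qed.

(** On one chain the order is fixed. Between two chains, comparing two points means choosing a side
    of a hyperplane, and a connected set in the complement stays on one side. *)
Lemma sub_cell L x z : L \in catalan_merges -> cell L x ->
  connected_component (arr_compl (asym_catalan c R)) x z -> cell L z.
Proof.
move=> Lin Lx [D [Dx DA cD] Dz]; rewrite /cell /=.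
have : {in L &, forall p q, below x p q -> below z p q}.
  move=> [i s] [j t]; rewrite !mem_catalan_merges //= => si tj.
  have [<-|ij] := eqVneq i j; first by rewrite /below /height /= !ltrD2l.
  pose b : R := (cat_half c i)%:R - (cat_half c j)%:R + t%:R - s%:R.
  have belowE y : below y (i, s) (j, t) = (y ord0 i - y ord0 j < b).
    by rewrite /below /height /start /b /=; apply/idP/idP; lra.
  rewrite !belowE; pose f (y : 'rV[R]_n) := y ord0 i - y ord0 j.
  apply: (@connected_lt _ _ D f b x z cD _ _ Dx Dz) => [y|y /DA].
    apply: (@continuousB R _ _ (fun y : 'rV[R]_n => y ord0 i)
      (fun y : 'rV[R]_n => y ord0 j)); exact: coord_continuous.
  move=> /arr_compl_generic gy; apply: contra (gy i j s t ij si tj) => /eqP yb.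
  by apply/eqP; rewrite /height /start /=; move: yb; rewrite /f /b; lra.
by move=> h; apply: (sub_in_sorted (P := [in L]) h) Lx; apply/allP.
Qed.

Lemma below_segment x z (t : R) p q : 0 <= t <= 1 ->
  below x p q -> below z p q -> below (x + t *: (z - x)) p q.
Proof.
move=> /andP[t0 t1]; rewrite /below -![height _ p < _]subr_gt0 => hx hz.
have -> : height (start (x + t *: (z - x))) q - height (start (x + t *: (z - x))) p =
    (1 - t) * (height (start x) q - height (start x) p) +
    t * (height (start z) q - height (start z) p).
  by rewrite /height /start !mxE; ring.
move: t0; rewrite le_eqVlt => /predU1P[<-|t0]; first by rewrite subr0 mul1r mul0r addr0.
apply: ltr_wpDl; last exact: mulr_gt0.
by apply: mulr_ge0; [rewrite subr_ge0|exact: ltW].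
Qed.

(** A cell is convex and lies in the complement, so segments join [x] to all its points. *)
Lemma component_cell L x : L \in catalan_merges -> cell L x ->
  connected_component (arr_compl (asym_catalan c R)) x = cell L.
Proof.
move=> Lin Lx; apply/seteqP; split=> z; first exact: sub_cell.
move=> Lz; apply: connected_component_segment => t t01.
apply/arr_compl_generic/(cell_generic Lin).
rewrite /cell /= (sorted_pairwise (@below_trans _)).
apply: (@sub_pairwise _ [rel p q | below x p q && below z p q]).
  by move=> p q /andP[]; exact: below_segment.
by rewrite pairwise_relI -!(sorted_pairwise (@below_trans _)); apply/andP.
Qed.

Lemma cell_realized L : L \in catalan_merges -> exists x, cell L x.
Proof.
move=> Lin.
have [//|y' _ pL] := merges_realized (y := fun=> 0) (l := 0 : R) (erefl _)
  (isT : valid c [::] [set: 'I_n]%SET) Lin.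
pose x : 'rV[R]_n := \row_i (y' i + (cat_half c i)%:R).
exists x.
have := path_sorted pL; rewrite sorted_map; congr (is_true (sorted _ _)).
apply/funext => p; apply/funext => q; rewrite /= /below /height /start !mxE.
by rewrite !addrK.
Qed.

Lemma regions_catalan :
  regions (asym_catalan c R) = cell @` [set` catalan_merges].
Proof.
have cellP x : arr_compl (asym_catalan c R) x ->
    exists2 L, L \in catalan_merges & cell L x.
  move=> /arr_compl_generic gx.
  (* A level below all the starts. *)
  pose l := - \sum_i `|start x i| - 1.
  have [|i _|L Lin pL] := generic_merge (erefl _)
    (isT : valid c [::] [set: 'I_n]%SET) gx (l := l).
  - by [].
  - have /lerNnormlW : `|start x i| <= \sum_i `|start x i|.
      by rewrite (bigD1 i) //= lerDl sumr_ge0.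
    by rewrite /l; lra.
  by exists L => //; have := path_sorted pL; rewrite sorted_map.
apply/seteqP; split=> [_ [x xA <-]|_ [L Lin <-]].
  by have [L Lin Lx] := cellP x xA; exists L => //; rewrite (component_cell Lin Lx).
have [x xL] := cell_realized Lin.
exists x; last by rewrite (component_cell Lin xL).
exact/arr_compl_generic/(cell_generic Lin xL).
Qed.

(** At a common point both lists are strictly increasing with the same members, hence equal. *)
Lemma cell_inj : {in catalan_merges &, injective cell}.
Proof.
move=> L L' Lin L'in LL'; have [x Lx] := cell_realized Lin.
have L'x : cell L' x by rewrite -LL'.
apply: (irr_sorted_eq (@below_trans x) (@below_irr x) Lx L'x) => p.
by rewrite !mem_catalan_merges.
Qed.

(** This is [size_merges] for the empty queue with no chain entered yet. *)
Lemma nregions_catalan :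
  (nregions (asym_catalan c R) * (\sum_i c i).+1`! = (n + \sum_i c i)`!)%N.
Proof.
have N : remaining c [::] [set: 'I_n]%SET = (n + \sum_i c i)%N.
  rewrite /remaining /queue_size /chains_size big_nil cardsT card_ord addnC; congr addn.
  by apply: eq_bigl => i; rewrite inE.
have := @size_merges _ c _ [::] [set: 'I_n]%SET (erefl _).
rewrite N /queue_size /chains_size big_nil mul1n addn0 => <-.
congr (_ * _`!)%N; last by congr _.+1; apply: eq_bigl => i; rewrite inE.
rewrite /nregions regions_catalan -N.
have -> : [set` catalan_merges] = [set` [fset L in catalan_merges]%fset].
  by apply/seteqP; split=> L /=; rewrite inE.
rewrite fset_set_image ?set_fsetK; last exact: finite_fset.
rewrite card_in_imfset /=; last first.
  by move=> L L'; rewrite !inE; exact: cell_inj.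
by rewrite card_fseq undup_id // uniq_merges.
Qed.

End Regions.

Theorem theorem5 (R : realType) (n : nat) (hn : (0 < n)%N)
    (c : 'I_n -> nat) (hc : forall i : 'I_n, (0 < c i)%N) :
  let C := (\sum_(i < n) c i)%N in
  charpoly (asym_catalan c R) =
    'X * \prod_(1 <= i < n) ('X - (C%:R)%:P - (i%:R)%:P)
  /\ (nregions (asym_catalan c R))%:R =
       (n`!)%:R / (C + 1)%:R * ('C(C + n, n))%:R :> rat.
Proof.
move=> C; split; first exact: charpoly_asym_catalan (Ordinal hn).
(* After multiplication by C!, both sides equal (C + n)!. *)
have E : (nregions (asym_catalan c R) * (C + 1) = n`! * 'C(C + n, n))%N.
  apply/eqP; rewrite -(eqn_pmul2r (fact_gt0 C)) -mulnA addn1 -factS.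
  rewrite nregions_catalan -/C addnC -(bin_fact (leq_addl C n)) addnK.
  by rewrite mulnA (mulnC n`!).
have C1 : (C + 1)%:R != 0 :> rat by rewrite addn1 pnatr_eq0.
by rewrite mulrAC -natrM -E natrM mulfK.
Qed.
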